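(* Let $A := [-2,2]^2\setminus(-1,1)^2\subset\mathbb{R}^2$, and let $D_i$ be the operator $d+d^*$ acting on smooth differential forms on $A$ that are supported away from the eight vertices of $A$ and satisfy absolute boundary conditions on $\partial A$. Let $D_e$ be the self-adjoint extension of $D_i$ in $L^2\Omega^*(A)$ which on $1$-forms is the minimal extension $(D_i)_{\min}$ (mapping to even-degree forms) and on even-degree forms is the maximal extension $(D_i)_{\max}$ (mapping to $1$-forms). Then: (i) restricted to $0$-forms, the kernel of $D_e$ is at least $1$-dimensional, i.e. $\dim\left(\ker(D_e)\cap L^2\Omega^0(A)\right)\ge 1$; (ii) restricted to $1$-forms, the kernel of $D_e$ is $0$, i.e. $\ker(D_e)\cap L^2\Omega^1(A)=0$.
   Context: $A=[-2,2]^2\setminus(-1,1)^2$ carries the Euclidean metric of $\mathbb{R}^2$. Its vertices are the eight points $(\pm2,\pm2)$ and $(\pm1,\pm1)$. Differential forms are real-valued, and smooth means smooth up to the boundary. ''Supported away from the vertices'' means that the support (a closed subset of $A$) contains none of the vertices. $L^2\Omega^k(A)$ is the Hilbert space of square-integrable $k$-forms on $A$ and $L^2\Omega^*(A)=L^2\Omega^0(A)\oplus L^2\Omega^1(A)\oplus L^2\Omega^2(A)$, with even part $L^2\Omega^0(A)\oplus L^2\Omega^2(A)$ and odd part $L^2\Omega^1(A)$. Here $d$ is the exterior derivative and $d^*$ its formal adjoint, so $d+d^*$ interchanges even and odd forms. A smooth form $\omega$ supported away from the vertices satisfies absolute boundary conditions if $\iota^*( *\omega)=0$, where $*$ is the Hodge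 star and $\iota\colon\partial A\to A$ is the inclusion; equivalently, the contraction of $\omega$ with vectors normal to the boundary is zero along $\partial A$. The domain $\mathrm{dom}(D_i)$ is the space of smooth forms on $A$ supported away from the vertices and satisfying absolute boundary conditions. Explicitly, its elements in each degree are: - degree $0$: smooth functions $f\colon A\to\mathbb{R}$ supported away from the vertices (no further condition); - degree $2$: forms $f\,dx\wedge dy$ with $f$ smooth, supported away from the vertices, and $f=0$ on $\partial A$; - degree $1$: forms $f\,dx+g\,dy$ with $f,g$ smooth and supported away from the vertices, $f=0$ on the vertical edges $\partial_vA=(\{\pm2\}\times[-2,2])\cup(\{\pm1\}\times[-1,1])$, and $g=0$ on the horizontal edges $\partial_hA=([-2,2]\times\{\pm2\})\cup([-1,1]\times\{\pm1\})$. The operator $D_i=d+d^*\colon L^2\Omega^*(A)\supset\mathrm{dom}(D_i)\to L^2\Omega^*(A)$ is densely defined, symmetric and closable. Minimal extension on $1$-forms: $(D_i)_{\min}\colon L^2\Omega^1(A)\to L^2\Omega^0(A)\oplus L^2\Omega^2(A)$ is the closure of $D_i$ restricted to $1$-forms. That is, $\omega\in\mathrm{dom}((D_i)_{\min})$ with $(D_i)_{\min}\omega=\eta$ iff there are $1$-forms $\omega_n\in\mathrm{dom}(D_i)$ with $\omega_n\to\omega$ and $(d+d^* )\omega_n\to\eta$ in $L^2$. Maximal extension on even forms: $(D_i)_{\max}\colon L^2\Omega^0(A)\oplus L^2\Omega^2(A)\to L^2\Omega^1(A)$ is the Hilbert space adjoint of $D_i$ restricted to $1$-forms. That is, $\omega\in\mathrm{dom}((D_i)_{\max})$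 with $(D_i)_{\max}\omega=\eta$ iff $\langle\omega,D_i\tau\rangle_{L^2}=\langle\eta,\tau\rangle_{L^2}$ for all $1$-forms $\tau\in\mathrm{dom}(D_i)$. With respect to the decomposition of $L^2\Omega^*(A)$ into even forms (first) and odd forms (second), $$D_e:=\begin{pmatrix}0&(D_i)_{\min}\\(D_i)_{\max}&0\end{pmatrix},$$ with domain $\mathrm{dom}((D_i)_{\max})\oplus\mathrm{dom}((D_i)_{\min})$. *)

(* Defs.v *)
From HB Require Import structures.
From mathcomp Require Import all_boot all_order all_algebra.
From mathcomp Require Import all_classical all_reals all_analysis.

Set Implicit Arguments.
Unset Strict Implicit.
Unset Printing Implicit Defensive.
Import Order.TTheory GRing.Theory Num.Theory.
Import numFieldNormedType.Exports.

Local Open Scope classical_set_scope.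
Local Open Scope ring_scope.

Section Annulus.
Variable R : realType.

Definition annulus : set (R * R) :=
  (`[-2, 2] `*` `[-2, 2]) `\` (`]-1, 1[ `*` `]-1, 1[).

Definition vertices : set (R * R) :=
  [set p | `|p.1| = 2 /\ `|p.2| = 2 \/ `|p.1| = 1 /\ `|p.2| = 1].

Definition vertical_edges : set (R * R) :=
  [set p | `|p.1| = 2 /\ `|p.2| <= 2 \/ `|p.1| = 1 /\ `|p.2| <= 1].

Definition horizontal_edges : set (R * R) :=
  [set p | `|p.2| = 2 /\ `|p.1| <= 2 \/ `|p.2| = 1 /\ `|p.1| <= 1].

Definition boundary : set (R * R) := vertical_edges `|` horizontal_edges.

Lemma measurable_annulus :
  measurable (annulus : set (measurableTypeR R * measurableTypeR R)).
Proof. by apply: measurableD; apply: measurableX; exact: measurable_itv. Qed.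

Definition area_measure
    : {measure set (measurableTypeR R * measurableTypeR R) -> \bar R} :=
  mrestr (lebesgue_measure \x lebesgue_measure)%E measurable_annulus.

(** Elements of [L2] are representatives: two of them denote the same vector of
    the Hilbert space iff they agree almost everywhere on the annulus. *)
Definition L2 := LfunType area_measure (lee1n 2).

Definition L2_inner (f g : R * R -> R) : R :=
  \int[area_measure]_p (f p * g p).

Definition L2_cvg (u : nat -> R * R -> R) (f : R * R -> R) : Prop :=
  ('N[area_measure]_2%:E[EFin \o (u n \- f)%R])%E @[n --> \oo] --> 0%E.

(** A form [f0 + f2 dx/\dy + f dx + g dy] of mixed degree is encoded as
    [((f0, f2), (f, g))]: even part first, odd part second.  The coefficients
    lie in [R * R -> R] for smooth forms and in [L2] for L^2 forms. *)
Definition forms (V : Type) : Type := ((V * V) * (V * V))%type.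

Definition inner2 (u v : (R * R -> R) * (R * R -> R)) : R :=
  L2_inner u.1 v.1 + L2_inner u.2 v.2.

Definition cvg2 (u : nat -> (R * R -> R) * (R * R -> R))
    (v : (R * R -> R) * (R * R -> R)) : Prop :=
  L2_cvg (fun n => (u n).1) v.1 /\ L2_cvg (fun n => (u n).2) v.2.

Definition pd_x (f : R * R -> R) (p : R * R) : R := 'D_((1, 0) : R * R) f p.
Definition pd_y (f : R * R -> R) (p : R * R) : R := 'D_((0, 1) : R * R) f p.

Fixpoint Ck (k : nat) (f : R * R -> R) : Prop :=
  if k is k'.+1 then
    [/\ forall p, differentiable f p, Ck k' (pd_x f) & Ck k' (pd_y f)]
  else continuous f.

(** A function on the annulus is smooth up to the boundary iff it is the
    restriction of a smooth function on the plane; we manipulate such an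
    extension.  Only its values on the annulus matter below, and there they
    determine its derivatives, the annulus being the closure of its
    interior. *)
Definition smooth (f : R * R -> R) : Prop := forall k, Ck k f.

Definition annulus_support (f : R * R -> R) : set (R * R) :=
  closure (annulus `&` [set p | f p != 0]).

Definition away_from_vertices (f : R * R -> R) : Prop :=
  annulus_support f `&` vertices = set0.

Definition test_function (f : R * R -> R) : Prop :=
  smooth f /\ away_from_vertices f.

(** Absolute boundary conditions [iota^*( *w) = 0]: here
    [*w = f2 + (f dy - g dx) + f0 dx/\dy], and [dx] (resp. [dy]) restricts to
    zero on the vertical (resp. horizontal) edges. *)
Definition dom_Di (w : forms (R * R -> R)) : Prop :=
  let: ((f0, f2), (f, g)) := w in
  [/\ test_function f0 /\ test_function f2,
      test_function f /\ test_function g,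
      forall p, boundary p -> f2 p = 0,
      forall p, vertical_edges p -> f p = 0 &
      forall p, horizontal_edges p -> g p = 0].

Definition ext_d (w : forms (R * R -> R)) : forms (R * R -> R) :=
  let: ((f0, _), (f, g)) := w in
  ((cst 0, pd_x g \- pd_y f), (pd_x f0, pd_y f0)).

(** The formal adjoint of [ext_d]:
    [d^* (f dx + g dy) = - (f_x + g_y)] and
    [d^* (f2 dx/\dy) = (f2)_y dx - (f2)_x dy]. *)
Definition codiff (w : forms (R * R -> R)) : forms (R * R -> R) :=
  let: ((_, f2), (f, g)) := w in
  ((\- (pd_x f \+ pd_y g), cst 0), (pd_y f2, \- pd_x f2)).

Definition Di (w : forms (R * R -> R)) : forms (R * R -> R) :=
  let: ((a0, a2), (a, a')) := ext_d w in
  let: ((b0, b2), (b, b')) := codiff w in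
  ((a0 \+ b0, a2 \+ b2), (a \+ b, a' \+ b')).

Definition one_form (u : (R * R -> R) * (R * R -> R)) : forms (R * R -> R) :=
  ((cst 0, cst 0), u).

Definition fun2 (u : L2 * L2) : (R * R -> R) * (R * R -> R) :=
  (u.1 : R * R -> R, u.2 : R * R -> R).

(** Unbounded operators are given by their graphs. *)
Definition Di_min (w eta : L2 * L2) : Prop :=
  exists u : nat -> (R * R -> R) * (R * R -> R),
    [/\ forall n, dom_Di (one_form (u n)),
        cvg2 u (fun2 w) &
        cvg2 (fun n => (Di (one_form (u n))).1) (fun2 eta)].

Definition Di_max (w eta : L2 * L2) : Prop :=
  forall t : (R * R -> R) * (R * R -> R), dom_Di (one_form t) ->
    inner2 (fun2 w) (Di (one_form t)).1 = inner2 (fun2 eta) t.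

Definition De (w eta : forms L2) : Prop :=
  Di_max w.1 eta.2 /\ Di_min w.2 eta.1.

Definition ker_De : set (forms L2) :=
  [set w | De w ((0, 0), (0, 0))].

Definition L2_null (f : L2) : Prop :=
  (f : R * R -> R) = (cst 0 : R * R -> R) %[ae area_measure].

Definition null_forms : set (forms L2) :=
  [set w | (L2_null w.1.1 /\ L2_null w.1.2) /\
           (L2_null w.2.1 /\ L2_null w.2.2)].

Definition L2Omega0 : set (forms L2) :=
  [set w | L2_null w.1.2 /\ (L2_null w.2.1 /\ L2_null w.2.2)].

Definition L2Omega1 : set (forms L2) :=
  [set w | L2_null w.1.1 /\ L2_null w.1.2].

(** Linear independence is understood modulo almost everywhere equality. *)
Definition dim_ge (n : nat) (V : set (forms L2)) : Prop :=
  exists v : 'I_n -> forms L2,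
    (forall i, V (v i)) /\
    forall c : 'I_n -> R,
      null_forms (\sum_(i < n) c i *: (v i : (L2 * L2) * (L2 * L2))) ->
      forall i, c i = 0.

End Annulus.

(* Main.v *)
Require Import Defs.
From mathcomp Require Import all_boot all_order all_algebra.
From mathcomp Require Import all_classical all_reals all_analysis.
From mathcomp Require Import ring lra measurable_realfun.

(** Both parts rest on one integration by parts: a [C^1] function that vanishes
    on the vertical edges has an [x]-derivative of zero integral over the
    annulus, and likewise for horizontal edges and [y]-derivatives
    ([integral_pd_x], [integral_pd_y]).  Indeed every horizontal line meets the
    annulus in segments whose endpoints lie on vertical edges, so the
    fundamental theorem of calculus kills each slice, and Fubini's theorem
    concludes.

    On [0]-forms, the constant function [1] is in the kernel of the maximal
    extension: pairing it with [D_i] of a test [1]-form [f dx + g dy] yields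
    the integral of [- (f_x + g_y)], which vanishes.  It spans a line since the
    annulus has positive area.

    On [1]-forms, the minimal extension is bounded below ([energy_bound]): if
    [f] vanishes on the vertical edges and [g] on the horizontal ones, then

      int (f^2 + g^2) <= C int ((f_x + g_y)^2 + (g_x - f_y)^2).

    Expanding the squares, the right-hand side is the Dirichlet energy of [f]
    and [g] plus twice the integral of the Jacobian [f_x g_y - f_y g_x].  The
    Jacobian is the divergence [(f g_y)_x - (f g_x)_y]
    of a field to which the integration by parts applies, because a
    function that vanishes along a horizontal edge has zero tangential
    derivative there; so its integral is zero ([integral_jacobian]).  The
    Dirichlet energy in turn controls the [L^2] norms by one-dimensional
    Poincare inequalities ([poincare_x], [poincare_y]).  Since the bound
    survives [L^2] limits, a [1]-form in the kernel of the closure, being a limit of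
    forms [u_n] with [D_i u_n] tending to zero, is a limit of forms that tend
    to zero ([Di_min_null_kernel]). *)

Set Implicit Arguments.
Unset Strict Implicit.
Unset Printing Implicit Defensive.
Import Order.TTheory GRing.Theory Num.Theory.
Import numFieldNormedType.Exports.

Local Open Scope classical_set_scope.
Local Open Scope ring_scope.

(** * Continuous functions on the plane are integrable over the annulus *)

Section PlaneIntegration.
Variable R : realType.
Local Notation plane := (measurableTypeR R * measurableTypeR R)%type.
Local Notation leb2 := (lebesgue_measure \x lebesgue_measure)%E.
Implicit Types f g k : R * R -> R.

(** The plane carries the product sigma-algebra rather than the one generated by
    its open sets; both coincide because an open set is a countable union of
    boxes with rational endpoints. *)
Lemma open_plane_measurable (U : set (R * R)) :
  open U -> measurable (U : set plane).
Proof.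
move=> oU.
pose box (a b c d : R) : set plane := `]a, b[ `*` `]c, d[.
have -> : U = \bigcup_(a : rat) \bigcup_(b : rat) \bigcup_(c : rat) \bigcup_(d : rat)
    (if `[< box (ratr a) (ratr b) (ratr c) (ratr d) `<=` U >]
     then box (ratr a) (ratr b) (ratr c) (ratr d) else set0).
  apply/seteqP; split=> [[x y] Uxy|p [a _ [b _ [c _ [d _]]]]]; last first.
    by case: asboolP => // + /= ?; exact.
  have /nbhs_ballP[e /= e0 eU] : nbhs (x, y) U by exact: open_nbhs_nbhs.
  have rl (t : R) : exists q : rat, ratr q \in `]t - e, t[.
    by apply: rat_in_itvoo; rewrite ltrBlDr ltrDl.
  have rr (t : R) : exists q : rat, ratr q \in `]t, t + e[.
    by apply: rat_in_itvoo; rewrite ltrDl.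
  have [a] := rl x; have [b] := rr x; have [c] := rl y; have [d] := rr y.
  rewrite !in_itv/= => /andP[d1 d2] /andP[c1 c2] /andP[b1 b2] /andP[a1 a2].
  exists a => //; exists b => //; exists c => //; exists d => //.
  case: asboolP => [_|]; first by split; rewrite /= in_itv/=; apply/andP.
  case=> -[u v] [/=]; rewrite !in_itv/= => /andP[u1 u2] /andP[v1 v2].
  apply: eU; split=> /=; rewrite /ball/= ltr_norml; lra.
do 4 (apply: bigcupT_measurable_rat => ?); case: asboolP => _ //.
by apply: measurableX; exact: measurable_itv.
Qed.

Lemma continuous_plane_measurable f :
  continuous f -> measurable_fun [set: plane] (f : plane -> measurableTypeR R).
Proof.
move=> cf; apply: (measurability _ (RGenOInfty.measurableE R)) => _ [_ [a ->] <-].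
rewrite setTI; apply: open_plane_measurable.
by apply: open_comp => // p _; exact: cf.
Qed.

Let sq : set (R * R) := `[-2, 2] `*` `[-2, 2].

Lemma continuous_bounded_annulus f : continuous f ->
  exists M : R, forall p, annulus p -> `|f p| <= M.
Proof.
move=> cf; have : compact (f @` sq).
  apply: continuous_compact; first exact: continuous_subspaceT.
  by apply: compact_setX; exact: segment_compact.
move=> /compact_bounded[M [_ /(_ (M + 1))]]; rewrite ltrDl ltr01 => /(_ isT) bM.
by exists (M + 1) => p [Ap _]; apply: bM; exists p.
Qed.

Lemma annulus_finite : (leb2 (@annulus R : set plane) < +oo)%E.
Proof.
apply: (@le_lt_trans _ _ (leb2 (sq : set plane))).
  apply: le_measure; rewrite ?inE; first exact: measurable_annulus.
    by apply: measurableX; exact: measurable_itv.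
  exact: subDsetl.
rewrite product_measure1E; [|exact: measurable_itv|exact: measurable_itv].
have l4 : lebesgue_measure (`[-2, 2] : set R) = (2 - - 2)%:E.
  rewrite lebesgue_measure_itv/= lte_fin ifT ?EFinB//; lra.
by rewrite /= l4 -EFinM ltry.
Qed.

Lemma ae_annulus : {ae @area_measure R, forall p, annulus p}.
Proof.
exists (~` @annulus R); split => //.
  by apply: measurableC; exact: measurable_annulus.
by rewrite /area_measure/= /mrestr setICl measure0.
Qed.

(** The area measure lives on the whole plane, where a continuous function may be
    unbounded; almost everywhere is enough, and the annulus has full measure. *)
Lemma continuous_integrable f : continuous f ->
  (@area_measure R).-integrable setT (EFin \o f).
Proof.
move=> cf; have [M bM] := continuous_bounded_annulus cf.
have mf := continuous_plane_measurable cf.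
apply/integrableP; split; first exact/measurable_EFinP.
apply: (@le_lt_trans _ _ ((`|M|)%:E * @area_measure R setT)%E).
  apply: integral_le_bound => //; first exact/measurable_EFinP.
  have := ae_annulus.
  apply: (@filterS _ _ (ae_filter_ringOfSetsType (area_measure R))) => p Ap _ /=.
  by rewrite lee_fin (le_trans (bM p Ap)) ?ler_norm.
rewrite lte_mul_pinfty// /area_measure/= /mrestr setTI; exact: annulus_finite.
Qed.

Lemma integral_area f : continuous f ->
  (\int[@area_measure R]_p (f p)%:E
   = \int[leb2]_(p in (@annulus R : set plane)) (f p)%:E)%E.
Proof.
move=> cf; have intf := continuous_integrable cf.
have mA := @measurable_annulus R.
have N0 : @area_measure R (~` @annulus R) = 0%E.
  by rewrite /area_measure/= /mrestr setICl measure0.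
have := negligible_integral (measurableC mA) measurableT intf N0.
rewrite setTD setCK => ->.
apply: eq_measure_integral => B mB BA.
by rewrite /area_measure/= /mrestr setIidl.
Qed.

Lemma integrable_annulus f : continuous f ->
  leb2.-integrable (@annulus R : set plane) (EFin \o f).
Proof.
move=> cf; have [M bM] := continuous_bounded_annulus cf.
apply: measurable_bounded_integrable.
- exact: measurable_annulus.
- exact: annulus_finite.
- by apply: measurable_funTS; exact: continuous_plane_measurable.
- exists M; split; first exact: num_real.
  by move=> x Mx p Ap; apply: le_trans (bM p Ap) (ltW Mx).
Qed.

End PlaneIntegration.

(** * Integration by parts on the annulus *)

Section PlaneCalculus.
Variable R : realType.
Local Notation mu := (@area_measure R).
Implicit Types f g k : R * R -> R.

(** Both sides are limits of the same difference quotients. *)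
Lemma is_derive_pd_x f x y : differentiable f (x, y) ->
  is_derive x 1 (fun t => f (t, y)) (pd_x f (x, y)).
Proof.
move=> /(@diff_derivable _ _ _ f (x, y) (1, 0)) df.
have E : (fun h : R => h^-1 *: (((fun t => f (t, y)) \o shift x) (h *: 1) - f (x, y)))
    = (fun h => h^-1 *: ((f \o shift (x, y)) (h *: (1, 0)) - f (x, y))).
  apply/funext => h /=; congr (_ *: (f _ - _)).
  by apply/pair_equal_spec; split=> //=; rewrite scaler0 add0r.
by split; rewrite /derivable/pd_x/derive E.
Qed.

Lemma is_derive_pd_y f x y : differentiable f (x, y) ->
  is_derive y 1 (fun t => f (x, t)) (pd_y f (x, y)).
Proof.
move=> /(@diff_derivable _ _ _ f (x, y) (0, 1)) df.
have E : (fun h : R => h^-1 *: (((fun t => f (x, t)) \o shift y) (h *: 1) - f (x, y)))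
    = (fun h => h^-1 *: ((f \o shift (x, y)) (h *: (0, 1)) - f (x, y))).
  apply/funext => h /=; congr (_ *: (f _ - _)).
  by apply/pair_equal_spec; split=> //=; rewrite scaler0 add0r.
by split; rewrite /derivable/pd_y/derive E.
Qed.

Lemma continuous_slice_x f y : continuous f -> continuous (fun t => f (t, y)).
Proof.
move=> cf x; apply: (cvg_comp (fun t => (t, y)) f _ (cf (x, y))).
exact: (cvg_pair (G := nbhs x) (H := nbhs y) cvg_id (cvg_cst y)).
Qed.

Lemma continuous_slice_y f x : continuous f -> continuous (fun t => f (x, t)).
Proof.
move=> cf y; apply: (cvg_comp (fun t => (x, t)) f _ (cf (x, y))).
exact: (cvg_pair (G := nbhs x) (H := nbhs y) (cvg_cst x) cvg_id).
Qed.

Lemma integral_derivative (F dF : R -> R) (a b : R) : a < b ->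
  (forall t : R, is_derive t 1 F (dF t)) -> continuous dF ->
  (\int[lebesgue_measure]_(t in `[a, b]) (dF t)%:E = (F b)%:E - (F a)%:E)%E.
Proof.
move=> ab FdF cdF.
have cF : continuous F.
  move=> t; apply: differentiable_continuous; apply/derivable1_diffP.
  by have [] := FdF t.
apply: continuous_FTC2 => //.
- exact: continuous_subspaceT.
- split=> [t _||]; first by have [] := FdF t.
  + by apply: cvg_at_right_filter; exact: cF.
  + by apply: cvg_at_left_filter; exact: cF.
- by move=> t _; rewrite derive1E; exact: derive_val.
Qed.

Lemma annulus_sym (x y : R) : annulus (x, y) -> annulus (y, x).
Proof. by move=> [[? ?] /= nxy]; split; [split|move=> [? ?]; apply: nxy; split]. Qed.

(** A horizontal slice of the annulus is empty, or [[-2, 2]], or the union of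
    [[-2, -1]] and [[1, 2]]: in all cases its endpoints lie on vertical edges. *)
Lemma annulus_slice_integral (F dF : R -> R) (y : R) :
    (forall t : R, is_derive t 1 F (dF t)) -> continuous dF ->
    (forall t, vertical_edges (t, y) -> F t = 0) ->
  (\int[lebesgue_measure]_(t in [set t | annulus (t, y)]) (dF t)%:E = 0)%E.
Proof.
move=> FdF cdF F0.
have int0 (a b : R) : a < b -> F a = 0 -> F b = 0 ->
    (\int[lebesgue_measure]_(t in `[a, b]) (dF t)%:E = 0)%E.
  by move=> ab Fa Fb; rewrite (integral_derivative ab FdF cdF) Fa Fb subee.
(* The slice misses the outer square. *)
have [y2|y2] := ltP 2 `|y|.
  rewrite (_ : [set t | _] = set0) ?integral_set0//.
  apply/seteqP; split=> // t [[_ /=]]; rewrite in_itv/= => y22 _.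
  by move: y2; rewrite ltNge ler_norml y22.
have y22 : (y : R) \in `[-2, 2] by rewrite in_itv/= -ler_norml.
(* The slice crosses the hole. *)
have [y1|y1] := ltP `|y| 1.
  have F2 : F (-2) = 0 /\ F 2 = 0.
    by split; apply: F0; left; rewrite /= ?normrN ger0_norm.
  have F1 : F (-1) = 0 /\ F 1 = 0.
    by split; apply: F0; right; rewrite /= ?normrN normr1 (ltW y1).
  move: y1 y22; rewrite ltr_norml in_itv/= => y1 y22.
  rewrite (_ : [set t | _] = `[-2, -1] `|` `[1, 2]); last first.
    apply/seteqP; split=> [t [[/=]]|t [|]]/=; rewrite !in_itv/=.
    - move=> /andP[t2 t3] _ tN.
      have [|t1] := leP t (- 1); first by left; rewrite t2.
      right; rewrite t3 andbT leNgt; apply/negP => t1'; apply: tN.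
      by split; rewrite /= ?in_itv/= ?t1 ?t1'.
    - move=> t12; split; first by split; rewrite /= ?in_itv/= //; lra.
      by move=> [/=]; rewrite ?in_itv/=; lra.
    - move=> t12; split; first by split; rewrite /= ?in_itv/= //; lra.
      by move=> [/=]; rewrite ?in_itv/=; lra.
  rewrite integral_setU_EFin//=.
  + rewrite !int0 ?adde0//; try lra; tauto.
  + apply: (measurable_funS measurableT) => //.
    exact: (@continuous_measurable_fun R dF cdF).
  + apply/disj_setPS => t [/=]; rewrite !in_itv/= => /andP[_ ?] /andP[? _]; lra.
rewrite (_ : [set t | _] = `[-2, 2]%classic).
  apply: int0; [lra|..]; apply: F0; left => /=; by rewrite ?normrN ger0_norm.
apply/seteqP; split=> [t [[]]//|t /= t2]; split; first by split.
by move=> [_ /=]; rewrite in_itv/= -ltr_norml ltNge y1.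
Qed.

Lemma integral_pd_x f : (forall p, differentiable f p) -> continuous (pd_x f) ->
  (forall p, vertical_edges p -> f p = 0) -> \int[mu]_p pd_x f p = 0.
Proof.
move=> df cf f0; rewrite /Rintegral integral_area//.
have := integrable_annulus cf; rewrite integrable_mkcond; last first.
  exact: measurable_annulus.
move=> intf; rewrite integral_mkcond -(integral21_prod_meas1 intf).
rewrite integral0_eq// => y _.
have := @annulus_slice_integral (fun t => f (t, y)) (fun t => pd_x f (t, y)) y.
move=> slice0; apply: etrans (slice0 _ _ _); first last.
- by move=> t; exact: f0.
- exact: continuous_slice_x.
- by move=> t; exact: is_derive_pd_x.
by rewrite [RHS]integral_mkcond; apply: eq_integral => t _; rewrite !patchE.
Qed.

Lemma integral_pd_y f : (forall p, differentiable f p) -> continuous (pd_y f) ->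
  (forall p, horizontal_edges p -> f p = 0) -> \int[mu]_p pd_y f p = 0.
Proof.
move=> df cf f0; rewrite /Rintegral integral_area//.
have := integrable_annulus cf; rewrite integrable_mkcond; last first.
  exact: measurable_annulus.
move=> intf; rewrite integral_mkcond -(integral12_prod_meas1 intf).
rewrite integral0_eq// => x _.
have := @annulus_slice_integral (fun t => f (x, t)) (fun t => pd_y f (x, t)) x.
move=> slice0; apply: etrans (slice0 _ _ _); first last.
- by move=> t xt; apply: (f0 (x, t)); exact: xt.
- exact: continuous_slice_y.
- by move=> t; exact: is_derive_pd_y.
rewrite [RHS]integral_mkcond; apply: eq_integral => t _; rewrite !patchE.
by congr (if _ then _ else _); apply/idP/idP; rewrite !in_setE; exact: annulus_sym.
Qed.

End PlaneCalculus.

(** * Symmetry of second derivatives and product rules *)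

Section MixedPartials.
Variable R : realType.

Lemma MVT_derivative (F dF : R -> R) (a b : R) : a < b ->
  (forall t : R, is_derive t 1 F (dF t)) ->
  exists2 c, a < c < b & F b - F a = dF c * (b - a).
Proof.
move=> ab FdF.
have cF : continuous F.
  move=> t; apply: differentiable_continuous; apply/derivable1_diffP.
  by have [] := FdF t.
have [//|c cab E] := MVT ab (fun t _ => FdF t).
  exact: continuous_subspaceT.
by exists c => //; move: cab; rewrite in_itv.
Qed.

(** Two applications of the mean value theorem, first in [s] to the difference
    of [F] between the two values of [t], then in [t]. *)
Lemma second_difference (F Fs Fst : R -> R -> R) (a b h : R) : 0 < h ->
    (forall s t : R, is_derive s 1 (F ^~ t) (Fs s t)) ->
    (forall s t : R, is_derive t 1 (Fs s) (Fst s t)) ->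
  exists s, exists t, [/\ a < s < a + h, b < t < b + h &
    F (a + h) (b + h) - F (a + h) b - (F a (b + h) - F a b) = Fst s t * h * h].
Proof.
move=> h0 dF dFs.
have ah : a < a + h by rewrite ltrDl.
have dphi (t : R) : is_derive t 1 (F ^~ (b + h) - F ^~ b) (Fs t (b + h) - Fs t b).
  exact: is_deriveB.
have [s sah /= Es] := MVT_derivative ah dphi.
have bh : b < b + h by rewrite ltrDl.
have [t tbh Et] := MVT_derivative bh (dFs s).
exists s, t; split => //; move: Es; rewrite !fctE => ->.
by rewrite Et; congr (_ * _); [congr (_ * _)|]; rewrite addrAC subrr add0r.
Qed.

(** Schwarz's theorem: the second difference over a small square at a point is
    [h ^+ 2] times a value of either mixed derivative at points of that square,
    and both values tend to those at the corner by continuity. *)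
Lemma mixed_partials (g : R * R -> R) : Ck 2 g -> pd_x (pd_y g) =1 pd_y (pd_x g).
Proof.
move=> [dg [dgx _ cgxy] [dgy cgyx _]] [a b].
set u := pd_x (pd_y g) in cgyx *; set v := pd_y (pd_x g) in cgxy *.
apply/eqP; rewrite -subr_eq0 -normr_le0; apply/ler_addgt0Pr => e e0; rewrite add0r.
have e20 : 0 < e / 2 by rewrite divr_gt0.
have /nbhs_ballP[d /= d0 du] : \forall q \near (a, b), `|u (a, b) - u q| < e / 2.
  by move/cvgrPdist_lt : (cgyx (a, b)); exact.
have /nbhs_ballP[d' /= d'0 dv] : \forall q \near (a, b), `|v (a, b) - v q| < e / 2.
  by move/cvgrPdist_lt : (cgxy (a, b)); exact.
pose h := Num.min d d'.
have h0 : 0 < h by rewrite lt_min d0.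
have [s [t [sa tb E]]] := second_difference (F := fun s t => g (s, t)) a b h0
  (fun s t => is_derive_pd_x (dg (s, t))) (fun s t => is_derive_pd_y (dgx (s, t))).
have [t' [s' [tb' sa' E']]] := second_difference (F := fun t s => g (s, t)) b a h0
  (fun t s => is_derive_pd_y (dg (s, t))) (fun t s => is_derive_pd_x (dgy (s, t))).
have uv : u (s', t') = v (s, t).
  have hh : h != 0 by rewrite gt_eqF.
  by apply: (mulIf hh); apply: (mulIf hh); rewrite -E -E'; ring.
clearbody u v; clear E E'.
have hd : h <= d by rewrite ge_min lexx.
have hd' : h <= d' by rewrite ge_min lexx orbT.
have {}du : `|u (a, b) - u (s', t')| < e / 2.
  by apply: du; split; rewrite /ball/= ltr_norml; lra.
have {}dv : `|v (a, b) - v (s, t)| < e / 2.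
  by apply: dv; split; rewrite /ball/= ltr_norml; lra.
rewrite uv in du; rewrite distrC in dv.
rewrite [leRHS]splitr; apply: le_trans (ler_distD (v (s, t)) _ _) _.
by apply: lerD; exact: ltW.
Qed.

End MixedPartials.

Section Products.
Variable R : realType.
Implicit Types f g : R * R -> R.

Lemma pd_xM f g p : differentiable f p -> differentiable g p ->
  pd_x (f \* g) p = f p * pd_x g p + g p * pd_x f p.
Proof. by move=> df dg; rewrite /pd_x deriveM//; exact: diff_derivable. Qed.

Lemma pd_yM f g p : differentiable f p -> differentiable g p ->
  pd_y (f \* g) p = f p * pd_y g p + g p * pd_y f p.
Proof. by move=> df dg; rewrite /pd_y deriveM//; exact: diff_derivable. Qed.

Lemma Ck1M f g : Ck 1 f -> Ck 1 g -> Ck 1 (f \* g).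
Proof.
move=> [df cfx cfy] [dg cgx cgy]; split=> [p||].
- exact: differentiableM.
- have -> : pd_x (f \* g) = (f \* pd_x g) \+ (g \* pd_x f).
    by apply/funext => p; rewrite pd_xM.
  by move=> p; apply: cvgD; apply: cvgM;
    [exact: differentiable_continuous|exact: cgx|
     exact: differentiable_continuous|exact: cfx].
- have -> : pd_y (f \* g) = (f \* pd_y g) \+ (g \* pd_y f).
    by apply/funext => p; rewrite pd_yM.
  by move=> p; apply: cvgD; apply: cvgM;
    [exact: differentiable_continuous|exact: cgy|
     exact: differentiable_continuous|exact: cfy].
Qed.

Lemma Ck1_fst : Ck 1 (fst : R * R -> R) /\ pd_x (fst : R * R -> R) =1 cst 1.
Proof.
have df p : differentiable (fst : R * R -> R) p.
  by apply: linear_differentiable => q; exact: cvg_fst.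
have fx : pd_x (fst : R * R -> R) = cst 1.
  by apply/funext => -[x y]; have [_ <-] := is_derive_pd_x (df (x, y)); rewrite derive_id.
have fy : pd_y (fst : R * R -> R) = cst 0.
  by apply/funext => -[x y]; have [_ <-] := is_derive_pd_y (df (x, y)); rewrite derive_cst.
by split=> [|p]; rewrite ?fx//; split=> //; rewrite ?fx ?fy => p; exact: cvg_cst.
Qed.

Lemma Ck1_snd : Ck 1 (snd : R * R -> R) /\ pd_y (snd : R * R -> R) =1 cst 1.
Proof.
have df p : differentiable (snd : R * R -> R) p.
  by apply: linear_differentiable => q; exact: cvg_snd.
have fx : pd_x (snd : R * R -> R) = cst 0.
  by apply/funext => -[x y]; have [_ <-] := is_derive_pd_x (df (x, y)); rewrite derive_cst.
have fy : pd_y (snd : R * R -> R) = cst 1.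
  by apply/funext => -[x y]; have [_ <-] := is_derive_pd_y (df (x, y)); rewrite derive_id.
by split=> [|p]; rewrite ?fy//; split=> //; rewrite ?fx ?fy => p; exact: cvg_cst.
Qed.

End Products.

(** * Energy estimate for one-forms *)

Section Energy.
Variable R : realType.
Local Notation mu := (@area_measure R).
Implicit Types f g : R * R -> R.

Lemma le_integral_area f g : continuous f -> continuous g ->
  (forall p, annulus p -> f p <= g p) -> \int[mu]_p f p <= \int[mu]_p g p.
Proof.
move=> cf cg fg; rewrite /Rintegral !integral_area//.
apply: le_Rintegral; [exact: measurable_annulus|exact: integrable_annulus..|].
exact: fg.
Qed.

Lemma integral_areaD f g : continuous f -> continuous g ->
  \int[mu]_p (f p + g p) = \int[mu]_p f p + \int[mu]_p g p.
Proof. by move=> cf cg; apply: RintegralD => //; exact: continuous_integrable. Qed.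

Lemma integral_areaZ (c : R) f : continuous f ->
  \int[mu]_p (c * f p) = c * \int[mu]_p f p.
Proof. by move=> cf; apply: RintegralZl => //; exact: continuous_integrable. Qed.

Lemma continuous_plane_add f g : continuous f -> continuous g ->
  continuous (fun p => f p + g p).
Proof. by move=> cf cg p; apply: cvgD; [exact: cf|exact: cg]. Qed.

Lemma continuous_plane_sub f g : continuous f -> continuous g ->
  continuous (fun p => f p - g p).
Proof. by move=> cf cg p; apply: cvgB; [exact: cf|exact: cg]. Qed.

Lemma continuous_plane_mul f g : continuous f -> continuous g ->
  continuous (fun p => f p * g p).
Proof. by move=> cf cg p; apply: cvgM; [exact: cf|exact: cg]. Qed.

Lemma continuous_plane_scale (c : R) f : continuous f ->
  continuous (fun p => c * f p).
Proof. by move=> cf p; apply: cvgM; [exact: cvg_cst|exact: cf]. Qed.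

Lemma continuous_Ck1 f : Ck 1 f -> continuous f.
Proof. by move=> [df _ _] p; exact: differentiable_continuous. Qed.

(** The function [x f^2] vanishes on the vertical edges, so the integral of its
    [x]-derivative [f^2 + 2 x f f_x] is zero.  As [|x| <= 2], the square
    [(f + 2 x f_x)^2 >= 0] yields [f^2 <= 2 (f^2 + 2 x f f_x) + 16 f_x^2]. *)
Lemma poincare_x f : Ck 1 f -> (forall p, vertical_edges p -> f p = 0) ->
  \int[mu]_p (f p * f p) <= 16 * \int[mu]_p (pd_x f p * pd_x f p).
Proof.
move=> C1f f0; have [C1x dx] := Ck1_fst R.
have cf := continuous_Ck1 C1f; have [df cfx _] := C1f.
have [dk ckx _] := Ck1M C1x (Ck1M C1f C1f).
have k0 : \int[mu]_p pd_x (fst \* (f \* f)) p = 0.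
  by apply: integral_pd_x dk ckx _ => p /f0 /= ->; rewrite !mulr0.
have kE p : pd_x (fst \* (f \* f)) p = f p * f p + 2 * (p.1 * (f p * pd_x f p)).
  rewrite pd_xM ?pd_xM//= ?dx/=; [ring| |]; first by case: C1x.
  exact: differentiableM.
have cff := continuous_plane_mul cf cf.
have cxx := continuous_plane_mul cfx cfx.
rewrite -integral_areaZ// -[leRHS]addr0 -(mulr0 2) -k0.
rewrite -integral_areaZ// -integral_areaD//; last 2 first.
- exact: continuous_plane_scale.
- exact: continuous_plane_scale.
apply: le_integral_area => //.
  by apply: continuous_plane_add; exact: continuous_plane_scale.
move=> [x y] [[/= + _] _]; rewrite in_itv/= kE /= => x2.
set F := f _; set G := pd_x f _.
have : 0 <= (F + 2 * x * G) ^+ 2 by exact: sqr_ge0.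
have : 0 <= (4 - x ^+ 2) * G ^+ 2 by apply: mulr_ge0; [nra|exact: sqr_ge0].
by rewrite !expr2; nra.
Qed.

Lemma poincare_y f : Ck 1 f -> (forall p, horizontal_edges p -> f p = 0) ->
  \int[mu]_p (f p * f p) <= 16 * \int[mu]_p (pd_y f p * pd_y f p).
Proof.
move=> C1f f0; have [C1y dy] := Ck1_snd R.
have cf := continuous_Ck1 C1f; have [df _ cfy] := C1f.
have [dk _ cky] := Ck1M C1y (Ck1M C1f C1f).
have k0 : \int[mu]_p pd_y (snd \* (f \* f)) p = 0.
  by apply: integral_pd_y dk cky _ => p /f0 /= ->; rewrite !mulr0.
have kE p : pd_y (snd \* (f \* f)) p = f p * f p + 2 * (p.2 * (f p * pd_y f p)).
  rewrite pd_yM ?pd_yM//= ?dy/=; [ring| |]; first by case: C1y.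
  exact: differentiableM.
have cff := continuous_plane_mul cf cf.
have cyy := continuous_plane_mul cfy cfy.
rewrite -integral_areaZ// -[leRHS]addr0 -(mulr0 2) -k0.
rewrite -integral_areaZ// -integral_areaD//; last 2 first.
- exact: continuous_plane_scale.
- exact: continuous_plane_scale.
apply: le_integral_area => //.
  by apply: continuous_plane_add; exact: continuous_plane_scale.
move=> [x y] [[/= _ +] _]; rewrite in_itv/= kE /= => y2.
set F := f _; set G := pd_y f _.
have : 0 <= (F + 2 * y * G) ^+ 2 by exact: sqr_ge0.
have : 0 <= (4 - y ^+ 2) * G ^+ 2 by apply: mulr_ge0; [nra|exact: sqr_ge0].
by rewrite !expr2; nra.
Qed.

(** In the relative interior of a horizontal edge, [g] vanishes along the edge
    and hence so does its tangential derivative; the endpoints of the edge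
    lie on vertical edges, where [f] vanishes. *)
Lemma tangential_derivative f g : (forall p, differentiable g p) ->
    (forall p, vertical_edges p -> f p = 0) ->
    (forall p, horizontal_edges p -> g p = 0) ->
  forall p, horizontal_edges p -> f p * pd_x g p = 0.
Proof.
move=> dg f0 g0 [x y] hp.
have inner (c : R) : `|x| < c -> (forall t, `|t| <= c -> horizontal_edges (t, y)) ->
    pd_x g (x, y) = 0.
  move=> xc ht; have [_ <-] := is_derive_pd_x (dg (x, y)).
  rewrite -[RHS](derive_cst (0 : R) (x : R) 1); apply: near_eq_derive.
  have : \forall t \near x, `|t| < c by exact: cvgr_norm_lt cvg_id _ xc.
  by apply: filterS => t tc; apply/g0/ht/ltW.
have corner (c : R) : `|x| <= c -> (forall t, `|t| <= c -> horizontal_edges (t, y)) ->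
    (`|x| = c -> vertical_edges (x, y)) -> f (x, y) * pd_x g (x, y) = 0.
  rewrite le_eqVlt => /orP[/eqP xc _ /(_ xc)/f0 ->|xc hc _]; first by rewrite mul0r.
  by rewrite (inner c)// mulr0.
case: (hp) => -[/= yE xc]; apply: (corner _ xc).
- by move=> t tc; left.
- by move=> xE; left; split => //=; rewrite yE.
- by move=> t tc; right.
- by move=> xE; right; split => //=; rewrite yE.
Qed.

(** By [mixed_partials], the Jacobian is the divergence [(f g_y)_x - (f g_x)_y]. *)
Lemma integral_jacobian f g : Ck 1 f -> Ck 2 g ->
    (forall p, vertical_edges p -> f p = 0) ->
    (forall p, horizontal_edges p -> g p = 0) ->
  \int[mu]_p (pd_x f p * pd_y g p + - 1 * (pd_y f p * pd_x g p)) = 0.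
Proof.
move=> C1f C2g f0 g0; have [dg C1gx C1gy] := C2g.
have cf := continuous_Ck1 C1f.
have [d1 c1 _] := Ck1M C1f C1gy; have [d2 _ c2] := Ck1M C1f C1gx.
have [df _ _] := C1f; have [dgx _ _] := C1gx; have [dgy _ _] := C1gy.
have k1 : \int[mu]_p pd_x (f \* pd_y g) p = 0.
  by apply: integral_pd_x d1 c1 _ => p /f0 /= ->; rewrite mul0r.
have k2 : \int[mu]_p pd_y (f \* pd_x g) p = 0.
  by apply: integral_pd_y d2 c2 _ => p; exact: tangential_derivative.
rewrite -(addr0 0) -{1}k1 -(mulr0 (-1)) -k2 -integral_areaZ// -integral_areaD//.
  apply: eq_Rintegral => p _; rewrite pd_xM// pd_yM// mixed_partials//; ring.
exact: continuous_plane_scale.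
Qed.

(** [E] is the squared [L^2] norm of [(d + d^* ) (f dx + g dy)]. *)
Lemma energy_bound f g : Ck 2 f -> Ck 2 g ->
    (forall p, vertical_edges p -> f p = 0) ->
    (forall p, horizontal_edges p -> g p = 0) ->
  let E := \int[mu]_p ((pd_x f p + pd_y g p) * (pd_x f p + pd_y g p)) +
           \int[mu]_p ((pd_x g p - pd_y f p) * (pd_x g p - pd_y f p)) in
  \int[mu]_p (f p * f p) <= 16 * E /\ \int[mu]_p (g p * g p) <= 16 * E.
Proof.
move=> C2f C2g f0 g0 E.
have [df C1fx C1fy] := C2f; have [dg C1gx C1gy] := C2g.
have [cfx cfy] := (continuous_Ck1 C1fx, continuous_Ck1 C1fy).
have [cgx cgy] := (continuous_Ck1 C1gx, continuous_Ck1 C1gy).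
have C1f : Ck 1 f by exact: And3 df cfx cfy.
have C1g : Ck 1 g by exact: And3 dg cgx cgy.
have J0 := integral_jacobian C1f C2g f0 g0.
have cJ : continuous (fun p => pd_x f p * pd_y g p + - 1 * (pd_y f p * pd_x g p)).
  apply: continuous_plane_add; first exact: continuous_plane_mul.
  by apply: continuous_plane_scale; exact: continuous_plane_mul.
have cD : continuous (fun p => (pd_x f p + pd_y g p) * (pd_x f p + pd_y g p)).
  by apply: continuous_plane_mul; exact: continuous_plane_add.
have cC : continuous (fun p => (pd_x g p - pd_y f p) * (pd_x g p - pd_y f p)).
  by apply: continuous_plane_mul; exact: continuous_plane_sub.
(* [e] is the integrand of [E] corrected by a multiple of the Jacobian, which
   turns it into the Dirichlet energy density without changing the integral. *)
pose e p := (pd_x f p + pd_y g p) * (pd_x f p + pd_y g p) +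
  ((pd_x g p - pd_y f p) * (pd_x g p - pd_y f p) +
   (-2) * (pd_x f p * pd_y g p + - 1 * (pd_y f p * pd_x g p))).
have ce : continuous e.
  apply: continuous_plane_add => //; apply: continuous_plane_add => //.
  exact: continuous_plane_scale.
have eE : \int[mu]_p e p = E.
  rewrite integral_areaD//; last first.
    by apply: continuous_plane_add => //; exact: continuous_plane_scale.
  rewrite integral_areaD//; last exact: continuous_plane_scale.
  by rewrite integral_areaZ// J0 mulr0 addr0.
have grad p : e p = pd_x f p ^+ 2 + pd_y f p ^+ 2 + pd_x g p ^+ 2 + pd_y g p ^+ 2.
  by rewrite /e; ring.
split.
- apply: le_trans (poincare_x C1f f0) _; rewrite ler_pM2l// -eE.
  apply: le_integral_area => //; first exact: continuous_plane_mul.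
  by move=> p _; rewrite grad -expr2 -!addrA lerDl !addr_ge0// sqr_ge0.
- apply: le_trans (poincare_y C1g g0) _; rewrite ler_pM2l// -eE.
  apply: le_integral_area => //; first exact: continuous_plane_mul.
  by move=> p _; rewrite grad -expr2 lerDr !addr_ge0// sqr_ge0.
Qed.

End Energy.

(** * The kernel of the minimal extension *)

Section Kernel.
Variable R : realType.
Local Notation plane := (measurableTypeR R * measurableTypeR R)%type.
Local Notation mu := (@area_measure R).
Local Notation N2 f := ('N[mu]_2%:E[EFin \o f%R])%E.
Implicit Types (f g h : R * R -> R) (a : L2 R).

Lemma Lnorm2_continuous h : continuous h ->
  N2 h = (Num.sqrt (\int[mu]_p (h p * h p)))%:E.
Proof.
move=> ch; rewrite unlock.
have E : (\int[mu]_p (`|(EFin \o h) p| `^ 2))%E = (\int[mu]_p (h p * h p))%:E.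
  rewrite /Rintegral fineK.
    apply: eq_integral => p _ /=.
    by rewrite powR_mulrn// real_normK ?num_real// expr2.
  apply: integrable_fin_num => //.
  exact: (continuous_integrable (continuous_plane_mul ch ch)).
rewrite E poweR_EFin powR12_sqrt//; apply: Rintegral_ge0 => p _.
by rewrite -expr2 sqr_ge0.
Qed.

(** Passing from squares to norms, [16 (s^2 + t^2) <= (4 (s + t))^2]. *)
Lemma Lnorm2_le f g h : continuous f -> continuous g -> continuous h ->
    \int[mu]_p (f p * f p) <=
      16 * (\int[mu]_p (g p * g p) + \int[mu]_p (h p * h p)) ->
  (N2 f <= 4%:E * (N2 g + N2 h))%E.
Proof.
move=> cf cg ch fgh; rewrite !Lnorm2_continuous// -EFinD -EFinM lee_fin.
set I := \int[mu]_p (g p * g p) in fgh *; set J := \int[mu]_p (h p * h p) in fgh *.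
have I0 : 0 <= I by apply: Rintegral_ge0 => p _; rewrite -expr2 sqr_ge0.
have J0 : 0 <= J by apply: Rintegral_ge0 => p _; rewrite -expr2 sqr_ge0.
rewrite -[leRHS]ger0_norm; last by rewrite mulr_ge0// addr_ge0 ?sqrtr_ge0.
rewrite -sqrtr_sqr ler_wsqrtr//; apply: le_trans fgh _.
rewrite -{1}(sqr_sqrtr I0) -{1}(sqr_sqrtr J0).
have : 0 <= Num.sqrt I * Num.sqrt J by rewrite mulr_ge0 ?sqrtr_ge0.
move: (Num.sqrt I) (Num.sqrt J) => s t; rewrite !expr2; lra.
Qed.

Lemma L2_limit_null (u : nat -> R * R -> R) a : (forall n, continuous (u n)) ->
  L2_cvg u a -> L2_cvg u (cst 0) -> L2_null a.
Proof.
move=> cu ua u0; have ma : measurable_fun [set: plane] (a : plane -> R) by [].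
have mu_ n : measurable_fun [set: plane] (u n) := continuous_plane_measurable (cu n).
have aE n : (a : R * R -> R) = ((a \- u n) \+ u n)%R.
  by apply/funext => p /=; rewrite subrK.
have aN n : (N2 a <= N2 (u n \- a)%R + N2 (u n \- cst 0)%R)%E.
  have -> : N2 (u n \- a)%R = N2 (a \- u n)%R.
    rewrite -oppe_Lnorm; apply: eq_Lnorm => p /=; by rewrite opprB.
  have -> : N2 (u n \- cst 0)%R = N2 (u n).
    by apply: eq_Lnorm => p /=; rewrite subr0.
  rewrite {1}(aE n); apply: minkowski_EFin => //; last by rewrite ler1n.
  exact: measurable_funB.
have lim0 : (fun n => N2 (u n \- a)%R + N2 (u n \- cst 0)%R)%E @ \oo --> 0%E.
  by rewrite -[X in _ --> X]adde0; apply: cvgeD.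
have Na : N2 a = 0%E.
  apply/eqP; rewrite eq_le Lnorm_ge0 andbT.
  by apply: cvge_ge lim0; apply: nearW.
have /(_ _ _ Na) ae0 := @Lnorm_eq0_eq0 _ _ _ mu (EFin \o a) 2%:E.
have {}ae0 : (EFin \o a : plane -> \bar R) = \0%E %[ae mu].
  by apply: ae0; [exact/measurable_EFinP|rewrite lte_fin].
by apply: (@filterS _ _ (ae_filter_ringOfSetsType mu)) ae0 => p /= /(_ I) [].
Qed.

Lemma L2_cvg_null (u : nat -> R * R -> R) a : (forall n, u n =1 cst 0) ->
  L2_null a -> L2_cvg u a.
Proof.
move=> u0 a0; apply: cvg_near_cst; apply: nearW => n.
have mua : measurable_fun [set: plane] (a : plane -> R) by [].
have -> : N2 (u n \- a)%R = N2 a.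
  by rewrite -oppe_Lnorm; apply: eq_Lnorm => p /=; rewrite u0 /= sub0r opprK.
have two_neq0 : (2%:E : \bar R) != 0%E by rewrite eqe.
rewrite -[RHS](Lnorm0 mu two_neq0) unlock; congr (_ `^ _)%E.
apply: ae_eq_integral => //.
- apply: (@measurableT_comp _ _ _ _ _ _ (fun x : \bar R => (x `^ 2)%E)) => //=.
    exact: (measurable_poweR _).
  by apply/measurable_EFinP; exact: measurableT_comp.
- by apply: (@filterS _ _ (ae_filter_ringOfSetsType mu)) a0 => p + _ /= => ->.
Qed.

(** Along the sequence that witnesses the closure, [energy_bound] dominates the
    norm of [u n] by that of [Di (u n)], which tends to zero. *)
Lemma Di_min_null_kernel (w : L2 R * L2 R) :
  Di_min w (0, 0) -> L2_null w.1 /\ L2_null w.2.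
Proof.
move=> [u [domu [u1 u2] [d1 d2]]].
have bound n : [/\ continuous (u n).1, continuous (u n).2,
    (N2 (u n).1 <= 4%:E * (N2 ((Di (one_form (u n))).1.1 \- cst 0)%R +
                          N2 ((Di (one_form (u n))).1.2 \- cst 0)%R))%E &
    (N2 (u n).2 <= 4%:E * (N2 ((Di (one_form (u n))).1.1 \- cst 0)%R +
                          N2 ((Di (one_form (u n))).1.2 \- cst 0)%R))%E].
  case: (u n) (domu n) => f g [_ [[sf _] [sg _]] _ f0 g0].
  have [C2f C2g] := (sf 2, sg 2).
  have [df C1fx C1fy] := C2f; have [dg C1gx C1gy] := C2g.
  have [cfx cfy] := (continuous_Ck1 C1fx, continuous_Ck1 C1fy).
  have [cgx cgy] := (continuous_Ck1 C1gx, continuous_Ck1 C1gy).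
  have cD : continuous (pd_x f \+ pd_y g) := continuous_plane_add cfx cgy.
  have cC : continuous (pd_x g \- pd_y f) := continuous_plane_sub cgx cfy.
  have -> : N2 ((Di (one_form (f, g))).1.1 \- cst 0)%R = N2 (pd_x f \+ pd_y g)%R.
    rewrite -[RHS]oppe_Lnorm; apply: eq_Lnorm => p /=.
    by rewrite subr0 add0r.
  have -> : N2 ((Di (one_form (f, g))).1.2 \- cst 0)%R = N2 (pd_x g \- pd_y f)%R.
    by apply: eq_Lnorm => p /=; rewrite subr0 addr0.
  have [Ef Eg] := energy_bound C2f C2g f0 g0.
  have [cf cg] : continuous f /\ continuous g := conj (sf 0%N) (sg 0%N).
  by split=> //; exact: Lnorm2_le.
have lim0 : (fun n => 4%:E * (N2 ((Di (one_form (u n))).1.1 \- cst 0)%R +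
    N2 ((Di (one_form (u n))).1.2 \- cst 0)%R))%E @ \oo --> 0%E.
  rewrite -[X in _ --> X](mule0 4%:E); apply: cvgeZl => //.
  by rewrite -[X in _ --> X]adde0; apply: cvgeD.
have u0 (v : nat -> R * R -> R) : (forall n, N2 (v n) <= 4%:E *
    (N2 ((Di (one_form (u n))).1.1 \- cst 0)%R +
     N2 ((Di (one_form (u n))).1.2 \- cst 0)%R))%E -> L2_cvg v (cst 0).
  move=> vb; apply: squeeze_cvge (cvg_cst 0%E) lim0.
  apply: nearW => n; rewrite Lnorm_ge0/=; apply: le_trans (vb n).
  by rewrite le_eqVlt; apply/orP; left; apply/eqP/eq_Lnorm => p /=; rewrite subr0.
split.
- apply: L2_limit_null u1 (u0 _ _) => n; by have [] := bound n.
- apply: L2_limit_null u2 (u0 _ _) => n; by have [] := bound n.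
Qed.

End Kernel.

(** * Constants and the kernel of the extension *)

Section Harmonic.
Variable R : realType.
Local Notation plane := (measurableTypeR R * measurableTypeR R)%type.
Local Notation mu := (@area_measure R).
Implicit Types (f g h : R * R -> R) (a : L2 R).

Lemma pd_cst0 : pd_x (cst 0 : R * R -> R) = cst 0 /\ pd_y (cst 0 : R * R -> R) = cst 0.
Proof. by split; apply/funext => p; exact: derive_cst. Qed.

Lemma test_function_cst0 : test_function (cst 0 : R * R -> R).
Proof.
split.
  elim=> [|k Ik] /=; first by move=> p; exact: cvg_cst.
  by have [-> ->] := pd_cst0; split=> // p; exact: differentiable_cst.
rewrite /away_from_vertices /annulus_support (_ : @annulus R `&` _ = set0).
  by rewrite closure0 set0I.
by apply/seteqP; split=> // p [_ /=]; rewrite eqxx.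
Qed.

Lemma dom_Di_cst0 : dom_Di (one_form (cst 0 : R * R -> R, cst 0 : R * R -> R)).
Proof. by have t0 := test_function_cst0; split. Qed.

(** The representatives of zero are limits of the constant sequence [0]. *)
Lemma null_Di_min (w : L2 R * L2 R) : L2_null w.1 -> L2_null w.2 -> Di_min w (0, 0).
Proof.
move=> w1 w2; have [x0 y0] := pd_cst0; exists (fun=> (cst 0, cst 0)); split.
- by move=> _; exact: dom_Di_cst0.
- by split; exact: L2_cvg_null.
- split; apply: L2_cvg_null => /=; rewrite ?x0 ?y0.
  + by move=> _ p /=; rewrite addr0 oppr0 addr0.
  + exact: aeW.
  + by move=> _ p /=; rewrite subr0 addr0.
  + exact: aeW.
Qed.

Lemma L2_inner_null a h : continuous h -> L2_null a -> L2_inner a h = 0.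
Proof.
move=> ch a0; rewrite /L2_inner /Rintegral (ae_eq_integral (cst 0%E)) ?integral0//.
- apply/measurable_EFinP; apply: measurable_funM => //; exact: continuous_plane_measurable.
- apply: (@filterS _ _ (ae_filter_ringOfSetsType mu)) a0 => p /(_ I) /= + _ => ->.
  by rewrite /cst mul0r.
Qed.

Lemma L2_inner0l h : L2_inner (0 : L2 R) h = 0.
Proof.
rewrite /L2_inner /Rintegral integral0_eq// => p _.
by rewrite mul0r.
Qed.

(** The annulus contains the corner square [[1, 2] x [1, 2]]. *)
Lemma area_gt0 : (0 < mu setT)%E.
Proof.
rewrite /area_measure/= /mrestr setTI.
apply: (@lt_le_trans _ _ ((lebesgue_measure \x lebesgue_measure)%E
   (`[1, 2] `*` `[1, 2] : set plane))).
  rewrite product_measure1E; [|exact: measurable_itv|exact: measurable_itv].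
  have l1 : lebesgue_measure (`[1, 2] : set R) = (2 - 1)%:E.
    rewrite lebesgue_measure_itv/= lte_fin ifT ?EFinB//; lra.
  by rewrite /= l1 -EFinM lte_fin; lra.
apply: le_measure; rewrite ?inE; last 2 first.
- exact: measurable_annulus.
- move=> [x y] [/=]; rewrite !in_itv/= => x12 y12; split.
    by split; rewrite /= in_itv/=; lra.
  by move=> [/=]; rewrite !in_itv/=; lra.
- by apply: measurableX; exact: measurable_itv.
Qed.

Lemma one_Lfun : (cst 1 : plane -> R) \in Lfun mu 2%:E.
Proof.
rewrite inE; apply/andP; split; first by rewrite inE; exact: measurable_cst.
rewrite inE/= /finite_norm Lnorm2_continuous ?ltry//.
by move=> p; exact: cvg_cst.
Qed.

Definition one_L2 : L2 R := @Lfun_Sub _ plane R mu 2%:E (lee1n 2) _ one_Lfun.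

(** The inner product of [1] with [d^*] of a test form is the integral of minus
    a divergence whose flux through the boundary is zero. *)
Lemma one_Di_max : Di_max (one_L2, 0) (0, 0).
Proof.
move=> [f g] [_ [[sf _] [sg _]] _ f0 g0]; rewrite /inner2 /fun2/= !L2_inner0l !addr0.
have [df C1fx _] := sf 2; have [dg _ C1gy] := sg 2.
have [cx cy] := (continuous_Ck1 C1fx, continuous_Ck1 C1gy).
have -> : L2_inner one_L2 (cst 0 \+ \- (pd_x f \+ pd_y g)) =
    \int[mu]_p (- 1 * (pd_x f p + pd_y g p)).
  by apply: eq_Rintegral => p _ /=; rewrite add0r mul1r mulN1r.
rewrite integral_areaZ ?integral_areaD//; last exact: continuous_plane_add.
by rewrite integral_pd_x// integral_pd_y// addr0 mulr0.
Qed.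

End Harmonic.

Theorem proposition2 (R : realType) :
  dim_ge 1 (@ker_De R `&` @L2Omega0 R) /\
  @ker_De R `&` @L2Omega1 R = @null_forms R.
Proof.
split.
  exists (fun=> ((@one_L2 R, 0), (0, 0))); split=> [_|c].
    split; last by split; [exact: aeW|split; exact: aeW].
    by split; [exact: one_Di_max|apply: null_Di_min; exact: aeW].
  rewrite big_ord1 => -[[c0 _] _] i; rewrite (ord1 i).
  have [] := @filter_ex _ _ (ae_properfilter_algebraOfSetsType (area_gt0 R)) _ c0.
  by move=> p /(_ I); rewrite -[LHS]/(c ord0 * 1) mulr1.
apply/seteqP; split=> [[w1 w2] [[_ wmin] w10]|[[w0 w2] wodd] [[w00 w20] [wf wg]]].
  by split; [exact: w10|exact: Di_min_null_kernel].
split; last by split.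
split; last exact: null_Di_min.
move=> [f g] [_ [[sf _] [sg _]] _ _ _].
have [[_ C1fx C1fy] [_ C1gx C1gy]] := (sf 2, sg 2).
have [cfx cfy] := (continuous_Ck1 C1fx, continuous_Ck1 C1fy).
have [cgx cgy] := (continuous_Ck1 C1gx, continuous_Ck1 C1gy).
have c0 : continuous (cst 0 : R * R -> R) by move=> p; exact: cvg_cst.
rewrite /inner2 !L2_inner0l !L2_inner_null ?addr0//=.
- exact: continuous_plane_add (continuous_plane_sub cgx cfy) c0.
- exact: continuous_plane_sub c0 (continuous_plane_add cfx cgy).
Qed.
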